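(* Let $n\ge 0$ and let $\tau$ be a framed $(2n,2n)$-tangle. Let $L\subset S^2\times S^1$ be the circular closure of $\tau$ in $S^2\times S^1$. Then the invariant $$\langle L, S^2\times S^1\rangle=\bigl(S^3;\,P_{2n,0}\circ\langle\tau\rangle\bigr)\in\mathbb Q(q^{1/2})$$ is a Laurent polynomial in $q$ (half-integer powers of $q$ being allowed).
   Context: Tangles are unoriented, framed, embedded in $\mathbb R^2\times[0,1]$, considered up to isotopy rel boundary. An $(m,n)$-tangle has $m$ standard marked endpoints on $\mathbb R^2\times\{0\}$ and $n$ on $\mathbb R^2\times\{1\}$; $\tau_2\circ\tau_1$ is stacking with $\tau_1$ applied first. A Temperley–Lieb (TL) tangle is one having a diagram (blackboard framing) without crossings and without closed circles. $\mathfrak C_n$ is the set of crossingless $n$-matchings, i.e. TL $(0,2n)$-tangles; $\tau^{\lozenge}$ is the tangle obtained from $\tau$ by rotation by $180^\circ$ about an axis lying in the blackboard plane and perpendicular to the time direction (so an $(m,n)$-tangle becomes an $(n,m)$-tangle). $\mathrm{QTL}_{m,n}$ is the $\mathbb Q(q^{1/2})$-vector space with basis $\langle\lambda\rangle$, $\lambda$ a TL $(m,n)$-tangle. Composition of tangles extends bilinearly, each closed circle being replaced by $-(q+q^{-1})$. The Kauffman bracket $\langle\tau\rangle\in \mathrm{QTL}_{m,n}$ of a framed $(m,n)$-tangle is obtained by replacing each crossing by $q^{1/2}$ times one smoothing plus $q^{-1/2}$ times the other, the convention being that adding a $+1$ framing twist to a strand multiplies the bracket by $-q^{3/2}$. For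 $x\in\mathrm{QTL}_{n,n}$, $(S^3;x)\in\mathbb Q(q^{1/2})=\mathrm{QTL}_{0,0}$ is the linear extension of the bracket of the circular (planar) closure of a tangle in $S^3$. $P_{2n,0}\in\mathrm{QTL}_{2n,2n}$ is the Jones–Wenzl projector $P_{2n,0}=\sum_{\alpha,\beta\in\mathfrak C_n}(B^{-1})_{\alpha\beta}\,\langle\beta\circ\alpha^{\lozenge}\rangle$, where $B_{\alpha\beta}=\langle\alpha^{\lozenge}\circ\beta\rangle=(-q-q^{-1})^{c}$, $c$ being the number of circles in $\alpha^\lozenge\circ\beta$ (the matrix $B$ is invertible). It is the unique combination of tangles $\langle\beta\circ\alpha^\lozenge\rangle$ satisfying $P_{2n,0}\circ\langle\alpha\rangle=\langle\alpha\rangle$ for all $\alpha\in\mathfrak C_n$. *)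

(* Defs.v *)
From HB Require Import structures.
From mathcomp Require Import all_boot all_order all_algebra.
From mathcomp Require Import zify.

Set Implicit Arguments.
Unset Strict Implicit.
Unset Printing Implicit Defensive.

Import GRing.Theory.
Local Open Scope ring_scope.

(* The field Q(q^{1/2}) is the fraction field of Q[q^{1/2}]: the polynomial
   variable is q^{1/2}, not q. *)
Definition Qq : fieldType := {fraction {poly rat}}.
Definition qhalf : Qq := tofrac 'X.
Definition q : Qq := qhalf ^+ 2.

Definition is_laurent (x : Qq) : Prop :=
  exists (p : {poly rat}) (k : nat), x = tofrac p / qhalf ^+ k.

Definition circle_value : Qq := - (q + q^-1).

(* Endpoints of an (m,n)-tangle: [inl] at the bottom (time 0), [inr] at the top
   (time 1), both numbered from left to right. *)
Definition endpoint (m n : nat) : finType := ('I_m + 'I_n)%type.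

(* Rank of an endpoint when the boundary of the rectangle is traversed
   counterclockwise: bottom from left to right, then top from right to left. *)
Definition boundary_rank m n (x : endpoint m n) : nat :=
  match x with
  | inl i => i
  | inr j => m + rev_ord j
  end.

Definition crossingless m n (f : {ffun endpoint m n -> endpoint m n}) : bool :=
  [forall x, forall y,
     ~~ [&& boundary_rank x < boundary_rank y,
            boundary_rank y < boundary_rank (f x)
          & boundary_rank (f x) < boundary_rank (f y)]%N].

Definition is_TL m n (f : {ffun endpoint m n -> endpoint m n}) : bool :=
  [&& [forall x, f (f x) == x], [forall x, f x != x] & crossingless f].

(* A tangle with a diagram without crossings and without closed circles is
   determined, up to isotopy rel boundary, by the way in which it pairs its
   endpoints: [f x] is the other end of the arc starting at [x]. *)
Definition TL (m n : nat) : finType :=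
  {f : {ffun endpoint m n -> endpoint m n} | is_TL f}.

Definition partner m n (f : TL m n) : endpoint m n -> endpoint m n := val f.

Definition TL_id_fun n : {ffun endpoint n n -> endpoint n n} :=
  [ffun x => match x with inl i => inr i | inr i => inl i end].

Lemma TL_id_subproof n : is_TL (TL_id_fun n).
Proof.
apply/and3P; split.
- by apply/forallP => -[] i; rewrite !ffunE.
- by apply/forallP => -[] i; rewrite !ffunE.
- apply/forallP => x; apply/forallP => y; apply/negP.
  by case: x y => [] i [] j; rewrite !ffunE /=; have := ltn_ord i;
    have := ltn_ord j; lia.
Qed.

Definition TL_id n : TL n n := Sub (TL_id_fun n) (TL_id_subproof n).

(* The two ends, at positions i and i+1, of a cup created at position i. *)
Definition cup_left n (i : 'I_n.+1) : 'I_n.+2 := widen_ord (leqnSn n.+1) i.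
Definition cup_right n (i : 'I_n.+1) : 'I_n.+2 := lift (cup_left i) i.

(* n parallel strands with a cup inserted at positions i, i+1 at the top. *)
Definition TL_cup_fun n (i : 'I_n.+1) : {ffun endpoint n n.+2 -> endpoint n n.+2} :=
  [ffun x => match x with
   | inl k => inr (lift (cup_left i) (lift i k))
   | inr j =>
       match unlift (cup_left i) j with
       | None => inr (cup_right i)
       | Some j' =>
           match unlift i j' with
           | None => inr (cup_left i)
           | Some k => inl k
           end
       end
   end].

Lemma TL_cup_subproof n (i : 'I_n.+1) : is_TL (TL_cup_fun i).
Proof.
have E1 k : TL_cup_fun i (inl k) = inr (lift (cup_left i) (lift i k)).
  by rewrite ffunE.
have E2 : TL_cup_fun i (inr (cup_left i)) = inr (cup_right i).
  by rewrite ffunE unlift_none.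
have E3 : TL_cup_fun i (inr (cup_right i)) = inr (cup_left i).
  by rewrite ffunE liftK unlift_none.
have E4 (k : 'I_n) : TL_cup_fun i (inr (lift (cup_left i) (lift i k))) = inl k.
  by rewrite ffunE !liftK.
have topP j : [\/ j = cup_left i, j = cup_right i
                | exists k : 'I_n, j = lift (cup_left i) (lift i k)].
  case: (unliftP (cup_left i) j) => [j'|] ->; last by constructor 1.
  case: (unliftP i j') => [k|] ->; last by constructor 2.
  by constructor 3; exists k.
apply/and3P; split.
- apply/forallP => -[k|j]; first by rewrite E1 E4.
  by case: (topP j) => [->|->|[k ->]]; rewrite ?E2 ?E3 ?E4 ?E2 ?E3 ?E1.
- apply/forallP => -[k|j]; first by rewrite E1.
  case: (topP j) => [->|->|[k ->]]; rewrite ?E2 ?E3 ?E4 //.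
    by apply/eqP => -[]; rewrite /bump; lia.
  by apply/eqP => -[]; rewrite /bump; lia.
- have hi := ltn_ord i.
  apply/forallP => -[k|j]; apply/forallP => -[l|j']; apply/negP;
    try (case: (topP j) => [->|->|[k ->]]);
    try (case: (topP j') => [->|->|[l ->]]);
    rewrite ?E1 ?E2 ?E3 ?E4 /= /bump /=;
    try (have hk : (k < n)%N := ltn_ord k); try (have hl : (l < n)%N := ltn_ord l);
    try case: (leqP i k) => ?; try case: (leqP i l) => ?; move=> /and3P[]; lia.
Qed.

Definition TL_cup n (i : 'I_n.+1) : TL n n.+2 :=
  Sub (TL_cup_fun i) (TL_cup_subproof i).

(* Rotation by 180 degrees about an axis of the blackboard plane perpendicular
   to time exchanges bottom and top and keeps the left-to-right order. *)
Definition swap_ends m n (x : endpoint m n) : endpoint n m :=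
  match x with inl i => inr i | inr j => inl j end.

Definition TL_rot_fun m n (f : TL m n) : {ffun endpoint n m -> endpoint n m} :=
  [ffun x => swap_ends (partner f (swap_ends x))].

Lemma TL_rot_subproof m n (f : TL m n) : is_TL (TL_rot_fun f).
Proof.
have swapK a b : cancel (@swap_ends a b) (@swap_ends b a) by case.
have rankE (x : endpoint n m) :
  (boundary_rank x + boundary_rank (swap_ends x)).+1 = (m + n)%N.
  by case: x => i /=; have := ltn_ord i; lia.
have /and3P[/forallP fK /forallP fN /forallP fC] := valP f.
apply/and3P; split.
- by apply/forallP => x; rewrite !ffunE /partner swapK (eqP (fK _)) swapK.
- apply/forallP => x; rewrite ffunE; apply: contra (fN (swap_ends x)).
  by rewrite /partner => /eqP {2}<-; rewrite swapK.
- apply/forallP => x; apply/forallP => y; apply/negP => /and3P[xy yfx fxfy].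
  have /forallP/(_ (partner f (swap_ends x)))/negP := fC (partner f (swap_ends y)).
  apply; rewrite /partner !(eqP (fK _)).
  move: yfx fxfy; rewrite !ffunE /partner.
  have := rankE x; have := rankE y.
  have := rankE (swap_ends (val f (swap_ends x))).
  have := rankE (swap_ends (val f (swap_ends y))).
  rewrite !swapK; move: xy; lia.
Qed.

Definition TL_rot m n (f : TL m n) : TL n m := Sub (TL_rot_fun f) (TL_rot_subproof f).

(* Gluing f (below) and g (above) along their n common endpoints. *)
Section Gluing.
Variables (m n p : nat) (f : TL m n) (g : TL n p).

Definition glue_point : finType := ('I_m + 'I_n + 'I_p)%type.

Definition lower_point (x : endpoint m n) : glue_point := inl x.

Definition upper_point (y : endpoint n p) : glue_point :=
  match y with inl j => inl (inr j) | inr k => inr k end.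

Definition outer_point (z : endpoint m p) : glue_point :=
  match z with inl i => inl (inl i) | inr k => inr k end.

Definition glue : rel glue_point := fun u v =>
  [exists x, (u == lower_point x) && (v == lower_point (partner f x))]
  || [exists y, (u == upper_point y) && (v == upper_point (partner g y))].

Definition is_composite (h : TL m p) : bool :=
  [forall z, connect glue (outer_point z) (outer_point (partner h z))].

Definition circles : nat :=
  n_comp glue [pred u | [forall z, ~~ connect glue (outer_point z) u]].

End Gluing.

Definition QTL (m n : nat) := {ffun TL m n -> Qq^o}.

Definition TLb m n (f : TL m n) : QTL m n := [ffun h => (h == f)%:R].

(* [qcomp y x] is y \circ x: x is applied first.  Exactly one h satisfies
   [is_composite f g h]. *)
Definition qcomp m n p (y : QTL n p) (x : QTL m n) : QTL m p :=
  [ffun h => \sum_(f : TL m n) \sum_(g : TL n p | is_composite f g h)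
      x f * y g * circle_value ^+ circles f g].

(* Joining the i-th bottom endpoint with the i-th top endpoint for every i. *)
Definition closure_rel n (f : TL n n) : rel (endpoint n n) := fun x y =>
  (y == partner f x) || (y == swap_ends x).

Definition closure_circles n (f : TL n n) : nat := n_comp (closure_rel f) predT.

(* (S^3; x) *)
Definition bracket_S3 n (x : QTL n n) : Qq :=
  \sum_(f : TL n n) x f * circle_value ^+ closure_circles f.

(* Blackboard-framed diagrams of framed (m,n)-tangles, cut by horizontal lines
   into layers containing a single cup, cap or crossing of the strands i, i+1.
   Every framed tangle has such a diagram, and the constructors stack a new
   layer on top.  In [Tcross i true] the strand going from the bottom at i to
   the top at i+1 is the overstrand; in [Tcross i false] it is the
   understrand. *)
Inductive tangle (m : nat) : nat -> Type :=
| Tid : tangle m m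
| Tcup n (i : 'I_n.+1) of tangle m n : tangle m n.+2
| Tcap n (i : 'I_n.+1) of tangle m n.+2 : tangle m n
| Tcross n (i : 'I_n.+1) (over : bool) of tangle m n.+2 : tangle m n.+2.

(* The assignment of q^{1/2} to the identity smoothing when [over] holds is the
   one for which a kink of writhe +1 contributes
   q^{1/2} (- q - q^{-1}) + q^{-1/2} = - q^{3/2}. *)
Definition bracket_cross n (i : 'I_n.+1) (over : bool) : QTL n.+2 n.+2 :=
  let a := if over then qhalf else qhalf^-1 in
  a *: TLb (TL_id n.+2) + a^-1 *: qcomp (TLb (TL_cup i)) (TLb (TL_rot (TL_cup i))).

Fixpoint bracket m n (t : tangle m n) : QTL m n :=
  match t in tangle _ n return QTL m n with
  | Tid => TLb (TL_id m)
  | Tcup _ i t' => qcomp (TLb (TL_cup i)) (bracket t')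
  | Tcap _ i t' => qcomp (TLb (TL_rot (TL_cup i))) (bracket t')
  | Tcross _ i over t' => qcomp (bracket_cross i over) (bracket t')
  end.

Definition matching (n : nat) : finType := TL 0 (2 * n).

(* Rows and columns are indexed by [matching n] through [enum_val]. *)
Definition gram n : 'M[Qq]_#|matching n| :=
  \matrix_(a, b)
    circle_value ^+ circles (enum_val b : matching n) (TL_rot (enum_val a : matching n)).

Definition JW0 n : QTL (2 * n) (2 * n) :=
  \sum_(a < #|matching n|) \sum_(b < #|matching n|)
    invmx (gram n) a b *:
      qcomp (TLb (enum_val b : matching n)) (TLb (TL_rot (enum_val a : matching n))).

(* The bracket of the circular closure of t in S^2 x S^1. *)
Definition bracket_S2S1 n (t : tangle (2 * n) (2 * n)) : Qq :=
  bracket_S3 (qcomp (JW0 n) (bracket t)).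

(* Main.v *)
Require Import Defs.
From mathcomp Require Import all_boot all_order all_algebra.
From mathcomp Require Import zify.

Set Implicit Arguments.
Unset Strict Implicit.
Unset Printing Implicit Defensive.

Import GRing.Theory.

(** Gluing P_{2n,0} to x and closing up computes the trace of the action of x on
the span of the crossingless matchings: P_{2n,0} is the sum of
(B^-1)_{ab} <b o a^rot>, the closure of b o a^rot o x is a^rot o (x o b), and
pairing x o b with all the a^rot through B^-1 returns the coefficient of b in
x o b.  That coefficient is a Laurent polynomial, since composition of diagrams
only produces powers of -(q + q^-1).  Nothing depends on B being invertible:
otherwise [invmx] returns B itself, whose entries are Laurent polynomials.

The composite of two TL tangles is a matching because the two involutions act on
each of the components of the glued graph as reflections of a cycle, and it is
crossingless because the number of crossings modulo 2 between two components can
be read off from the order of their points along each of the boundaries. *)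

(** * Connected components *)

Lemma connect_homo (T T' : finType) (e : rel T) (e' : rel T') (h : T -> T') :
    (forall x y, e x y -> connect e' (h x) (h y)) ->
  forall x y, connect e x y -> connect e' (h x) (h y).
Proof.
move=> eh x y /connectP[p e_p ->] {y}.
elim: p x e_p => [|y p IHp] x /=; first by rewrite connect0.
by move=> /andP[/eh exy /IHp]; apply: connect_trans.
Qed.

(** The maps [h] and [k] need only be inverse up to connectedness, so points may be merged or
    duplicated when two gluings of the same curves are compared. *)
Lemma n_comp_equiv (T T' : finType) (e : rel T) (e' : rel T')
    (h : T -> T') (k : T' -> T) :
    connect_sym e -> connect_sym e' ->
    (forall x y, e x y -> connect e' (h x) (h y)) ->
    (forall x y, e' x y -> connect e (k x) (k y)) ->
    (forall x, connect e x (k (h x))) -> (forall x, connect e' x (h (k x))) ->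
  n_comp e T = n_comp e' T'.
Proof.
move=> syme syme' eh ek kh hk.
rewrite (adjunction_n_comp k syme syme' (a := T)) //.
apply: (intro_adjunction syme' _ (fun x _ => h x)) => // [x _|x _].
  by split=> // y _; apply: eh.
by split=> // y; apply: ek.
Qed.

(** [Z] stands for the outer endpoints of a glued diagram, [s] for arcs closing it up from
    outside. *)
Definition extend_rel (T Z : finType) (e : rel T) (i : Z -> T) (s : rel Z) : rel T :=
  fun u v => e u v || [exists z, exists z', [&& u == i z, v == i z' & s z z']].

Section Extend.
Variables (T Z : finType) (e : rel T) (i : Z -> T) (s r : rel Z).
Hypotheses (syme : symmetric e) (syms : symmetric s) (symr : symmetric r).
Hypothesis er : forall z z', connect e (i z) (i z') = connect r z z'.
Let es := extend_rel e i s.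
Let rs := [rel x y | r x y || s x y].

Lemma extend_rel_sym : symmetric es.
Proof.
move=> u v; rewrite /es /extend_rel syme; congr orb.
by apply/existsP/existsP => -[z /existsP[z' /and3P[u1 v1 zz]]];
  exists z'; apply/existsP; exists z; rewrite u1 v1 syms.
Qed.

Lemma connect_extend_l u v : connect e u v -> connect es u v.
Proof. by apply: connect_sub => x y exy; rewrite connect1 // /es /extend_rel exy. Qed.

Lemma connect_extend_r z z' : connect rs z z' -> connect es (i z) (i z').
Proof.
apply: connect_homo => {}z {}z' /orP[rzz'|szz'].
  by rewrite connect_extend_l // er connect1.
apply/connect1/orP; right; apply/existsP; exists z; apply/existsP; exists z'.
by rewrite !eqxx.
Qed.

(** Cut the path at its [s]-edges: each stretch of [e] between two of them joins points of the image
    of [i], hence is traced by [r] through [er]. *)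
Lemma connect_extendP z u :
  connect es (i z) u -> exists2 z', connect rs z z' & connect e (i z') u.
Proof.
case/connectP=> p; elim/last_ind: p u => [|p v IHp] u /=.
  by move=> _ ->; exists z.
rewrite rcons_path last_rcons => /andP[/IHp/(_ erefl)[z' zz' z'u] euv] ->.
case/orP: euv => [euv|/existsP[z1 /existsP[z2 /and3P[/eqP z1E /eqP -> sz]]]].
  by exists z' => //; apply: connect_trans z'u (connect1 euv).
exists z2 => //; apply: connect_trans zz' _.
rewrite z1E er in z'u; apply: connect_trans (_ : connect rs z' z1) _.
  by apply: connect_sub z'u => x y rxy; rewrite connect1 //= rxy.
by rewrite connect1 //= sz orbT.
Qed.

Lemma connect_extend z z' : connect es (i z) (i z') = connect rs z z'.
Proof.
apply/idP/idP; last exact: connect_extend_r.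
move=> /connect_extendP[z1 zz1]; rewrite er => z1z'.
apply: connect_trans zz1 _.
by apply: connect_sub z1z' => x y rxy; rewrite connect1 //= rxy.
Qed.

(** Components of [e] missing the image of [i] survive unchanged; every other component of [es]
    meets that image and is seen by [rs] on [Z]. *)
Lemma n_comp_extend :
  n_comp es T = n_comp e [pred u | [forall z, ~~ connect e (i z) u]] + n_comp rs Z.
Proof.
have symE := sym_connect_sym syme; have symES := sym_connect_sym extend_rel_sym.
have symRS : connect_sym rs.
  by apply: sym_connect_sym => x y /=; rewrite symr syms.
pose a := [pred u | [forall z, ~~ connect e (i z) u]].
have inner x : x \in a -> es x =1 e x.
  move=> /forallP xa y; rewrite /es /extend_rel; case: existsP; rewrite ?orbF //.
  by case=> z /existsP[z' /and3P[/eqP xz _ _]]; have := xa z; rewrite xz connect0.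
have cle : closed e a.
  apply: intro_closed => // x y exy /forallP xa; apply/forallP => z.
  by apply: contra (xa z) => /connect_trans -> //; rewrite symE connect1.
have cles : closed es a.
  by apply: intro_closed => // x y /[swap] xa; rewrite inner // => /cle <-.
rewrite (n_compC a); congr addn.
  rewrite (adjunction_n_comp id symES symE) //.
  apply: (intro_adjunction symE _ (fun x _ => x)) => // x xa.
    by split=> // y _; rewrite inner //; apply: connect1.
  by split=> // y exy; apply: connect_extend_l; rewrite connect1.
rewrite (adjunction_n_comp i symES symRS) //; last 2 first.
- exact: predC_closed.
- split=> [x|z z' _]; last by rewrite connect_extend.
  rewrite !inE negb_forall => /existsP/sigW[z]; rewrite negbK => zx.
  by exists z; rewrite symES connect_extend_l.
apply: eq_n_comp_r => z; rewrite !inE negb_forall; apply/existsP; exists z.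
by rewrite connect0.
Qed.

End Extend.

(* The orbit of z under g \o f carries all the points of the component of z, and
   g and f act on it as reflections of a cycle: besides z, they fix only the
   antipode of z. *)
Section TwoInvolutions.
Variables (T : finType) (f g : T -> T) (z : T).
Hypotheses (fK : involutive f) (gK : involutive g) (gz : g z = z).
Let e : rel T := fun x y => (y == f x) || (y == g x).
Let s x := g (f x).
Let L := order s z.

Let s_inj : injective s.
Proof. by apply: inj_comp; apply: inv_inj. Qed.

(** The dihedral relation: conjugation by [g] inverts [s]. *)
Let iter_gK k x : iter k s (g (iter k s x)) = g x.
Proof.
elim: k x => // k IHk x; rewrite iterSr iterS.
by rewrite {2}/s gK fK IHk.
Qed.

Let iter_g k : iter k s (g (iter k s z)) = z.
Proof. by rewrite iter_gK. Qed.

(** By [iter_g] the orbit of [z] under [s] is stable under [g], hence under [f], which is [g] after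
    [s]. *)
Lemma connect_involutions x : connect e z x -> fconnect s z x.
Proof.
have gP y : fconnect s z y -> fconnect s z (g y).
  move=> /iter_findex <-; rewrite (fconnect_sym s_inj).
  set k := findex s z y.
  by have := fconnect_iter s k (g (iter k s z)); rewrite iter_g.
case/connectP=> p; elim/last_ind: p x => [|p v IHp] x /=.
  by move=> _ ->; rewrite connect0.
rewrite rcons_path last_rcons => /andP[/IHp/(_ erefl)zx exv] ->.
case/orP: exv => /eqP -> ; last exact: gP.
by rewrite -[f _]gK; apply: gP; apply: connect_trans zx (fconnect1 s _).
Qed.

(** Write x = s^k z with 0 < k < L. Being fixed by [f] forces s^(2k+1) z = z, being fixed by [g]
    forces s^(2k) z = z. That exponent is a positive multiple of L below 2L, so it is L. *)
Lemma fixed_involutions x :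
    connect e z x -> x != z -> (f x == x) || (g x == x) ->
  x = iter L./2 s z.
Proof.
move=> /connect_involutions zx; have kL := findex_max zx.
have := iter_findex zx; move: kL; rewrite -/L; move: (findex s z x) => k kL <-.
move=> kz fixk.
have [n nE nk] : exists2 n, iter n s z = z & (n == k.*2) || (n == k.*2.+1).
  case/orP: fixk => /eqP fixk.
    exists k.*2.+1; rewrite ?eqxx ?orbT //.
    rewrite -[k.*2.+1]addn1 -addnn -addnA iterD addn1 iterS.
    by rewrite [s (iter _ _ _)]/s fixk iter_g.
  by exists k.*2; rewrite ?eqxx // -addnn iterD -fixk iter_g.
have k0 : 0 < k by case: k kz {kL fixk nE nk} => //=; rewrite eqxx.
have L0 : iter L s z = z by rewrite iter_order.
have small m : m < L -> iter m s z = z -> m = 0.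
  by move=> mL /(congr1 (findex s z)); rewrite findex_iter // findex0.
have Ln : L <= n by rewrite leqNgt; apply/negP => /small/(_ nE); lia.
have nLL : n - L < L by lia.
have : n - L = 0 by apply: small => //; rewrite -[in LHS]L0 -iterD subnK.
by move=> nL; congr (iter _ s z); lia.
Qed.

(** The point s^(L/2) z, with the half rounded down, is fixed by [f] when L is odd and by [g] when L
    is even; L > 1 separates it from [z]. *)
Lemma fixed_involutions_ex :
    f z != z ->
  exists x, [/\ connect e z x, x != z & (f x == x) || (g x == x)].
Proof.
move=> fz; have L0 : iter L s z = z by rewrite iter_order.
have Lgt0 : 0 < L by apply: order_gt0.
have L1 : 1 < L.
  rewrite ltn_neqAle Lgt0 andbT; apply: contra fz => /eqP L1.
  by move: L0; rewrite -L1 /= /s => /(congr1 g); rewrite gK gz => ->.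
exists (iter L./2 s z); split.
- elim: (L./2) => [|k IHk]; first by rewrite connect0.
  apply: connect_trans IHk _; rewrite iterS.
  apply: connect_trans (_ : connect e _ (f (iter k s z))) _.
    by rewrite connect1 // /e eqxx.
  by rewrite connect1 // /e eqxx orbT.
- apply/eqP => /(congr1 (findex s z)); rewrite findex_iter -/L; last lia.
  by rewrite findex0; lia.
have iinj k : injective (iter k s) by elim: k => //= k IHk x y /s_inj/IHk.
have := odd_double_half L; case: (odd L) => /= LE; apply/orP.
  left; apply/eqP; rewrite -[f _]gK; apply: (iinj (L./2).+1).
  rewrite -[g (f _)]/(iter (L./2).+1 s z) iter_g -iterD -[LHS]L0.
  by congr (iter _ s z); lia.
right; apply/eqP; apply: (iinj L./2).
by rewrite iter_g -iterD -[LHS]L0; congr (iter _ s z); lia.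
Qed.

End TwoInvolutions.

(** The component is a path alternating between [f] and [g]; [z] is one end of it and the antipode
    is the other. *)
Lemma involution_antipode (T : finType) (f g : T -> T) (z : T)
    (e : rel T := fun x y => (y == f x) || (y == g x)) :
    involutive f -> involutive g -> (f z == z) (+) (g z == z) ->
  exists x, [/\ connect e z x, x != z, (f x == x) || (g x == x)
    & forall y, connect e z y -> (f y == y) || (g y == y) -> y = z \/ y = x].
Proof.
wlog gz : f g @e / g z = z => [wlg fK gK fgz|fK gK].
  have [gz|gz] := eqVneq (g z) z; first exact: wlg.
  have fz : f z = z by apply/eqP; move: fgz; rewrite (negbTE gz) addbF.
  have eE : e =2 fun x y => (y == g x) || (y == f x) by move=> x y; apply: orbC.
  have [|x [zx xz fgx xP]] := wlg g f fz gK fK; first by rewrite addbC.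
  exists x; rewrite (eq_connect eE) orbC; split=> // y.
  by rewrite (eq_connect eE) orbC; apply: xP.
rewrite gz eqxx addbT => fz.
have [x [zx xz fgx]] := fixed_involutions_ex fK gK gz fz.
exists x; split=> // y zy fgy; have [->|yz] := eqVneq y z; first by left.
by right; rewrite (fixed_involutions fK gK gz zx) // (fixed_involutions fK gK gz zy).
Qed.

(** * Composition of TL tangles *)

Section PartnerTheory.
Variables (m n : nat) (f : TL m n).

Lemma partnerK : involutive (partner f).
Proof. by case/and3P: (valP f) => /forallP fK _ _ x; apply/eqP/fK. Qed.

Lemma partner_neq x : partner f x != x.
Proof. by case/and3P: (valP f) => _ /forallP fN _; apply: fN. Qed.

Lemma partner_noncrossing x y :
  ~~ [&& boundary_rank x < boundary_rank y,
         boundary_rank y < boundary_rank (partner f x)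
       & boundary_rank (partner f x) < boundary_rank (partner f y)].
Proof. by case/and3P: (valP f) => _ _ /forallP/(_ x)/forallP; apply. Qed.

End PartnerTheory.

Lemma boundary_rank_inj m n : injective (@boundary_rank m n).
Proof.
move=> [i|i] [j|j] /=; have := ltn_ord i; have := ltn_ord j => ? ? ij.
- by congr inl; apply: val_inj.
- by lia.
- by lia.
- by congr inr; apply: val_inj => /=; lia.
Qed.

Lemma sum_pair (T : finType) (F : T -> nat) (x y : T) : y != x ->
  (forall z, z != x -> z != y -> F z = 0) -> \sum_z F z = F x + F y.
Proof.
move=> yx F0; rewrite (bigD1 x) //= (bigD1 y) //= big1 ?addn0 // => z /andP[zx zy].
exact: F0.
Qed.

(** * Parity of crossings between families of chords *)

Section NoncrossingParity.
Variables (T : finType) (r : T -> nat) (f : T -> T).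
Hypotheses (r_inj : injective r) (fK : involutive f) (f_neq : forall x, f x != x).

Lemma sum_involution (F : T -> nat) :
  \sum_x F x = \sum_(x | r x < r (f x)) (F x + F (f x)).
Proof.
rewrite big_split /= (bigID (fun x => r x < r (f x))) /=; congr addn.
rewrite (reindex_inj (inv_inj fK)) /=; apply: eq_bigl => x; rewrite fK -leqNgt.
by rewrite [RHS]ltn_neqAle (inj_eq r_inj) eq_sym f_neq.
Qed.

Lemma even_closed (A : pred T) :
  (forall x, A (f x) = A x) -> ~~ odd (\sum_x A x).
Proof.
move=> Af; rewrite -dvdn2 sum_involution; apply: dvdn_sum => x _.
by rewrite Af addnn dvdn2 odd_double.
Qed.

Hypothesis noncrossing :
  forall x y, ~~ [&& r x < r y, r y < r (f x) & r (f x) < r (f y)].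

(* Two chords cross exactly when an odd number of the four pairs of their
   endpoints are in increasing order. *)
Lemma even_crossings (A B : pred T) :
    (forall x, A (f x) = A x) -> (forall x, B (f x) = B x) ->
    (forall x, ~~ (A x && B x)) ->
  ~~ odd (\sum_x \sum_y [&& A x, B y & r x < r y]).
Proof.
move=> Af Bf AB; rewrite -dvdn2 sum_involution; apply: dvdn_sum => x xfx.
rewrite -big_split sum_involution; apply: dvdn_sum => y yfy.
rewrite !Af !Bf; have := AB x; have := AB y; have := AB (f y).
rewrite Af Bf; case: (boolP (A x)) => //= Ax; case: (boolP (B y)) => //= By.
rewrite !andbT => Afy Ay Bx.
(* The ends of the first chord lie in [A] and those of the second do not, so no ranks coincide
   between the chords. Of the orders left, the two noncrossing conditions keep those with an even
   count. *)
have neq u v : A u != A v -> r u != r v.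
  by rewrite (inj_eq r_inj); apply: contraNneq => ->.
have := neq x y; have := neq (f x) y; have := neq x (f y); have := neq (f x) (f y).
rewrite !Af Ax (negbTE Ay) => /(_ isT) ? /(_ isT) ? /(_ isT) ? /(_ isT) ?.
have := noncrossing x y; have := noncrossing y x.
case: (ltnP (r x) (r y)); case: (ltnP (r x) (r (f y)));
  case: (ltnP (r (f x)) (r y)); case: (ltnP (r (f x)) (r (f y))) => //=; lia.
Qed.

End NoncrossingParity.

Definition ordered_pairs n (P Q : pred 'I_n) : nat :=
  \sum_i \sum_j [&& P i, Q j & i < j].

(** Disjointness excludes i = j, so each pair is counted in exactly one of the two orders. *)
Lemma ordered_pairsC n (P Q : pred 'I_n) : (forall i, ~~ (P i && Q i)) ->
  ordered_pairs P Q + ordered_pairs Q P = (\sum_i P i) * (\sum_i Q i).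
Proof.
move=> PQ; rewrite /ordered_pairs [X in _ + X]exchange_big -big_split big_distrl /=.
apply: eq_bigr => i _; rewrite -big_split big_distrr /=; apply: eq_bigr => j _.
have [->|ij] := eqVneq i j; first by rewrite ltnn !andbF mulnb (negbTE (PQ j)).
have {}ij : (i : nat) != j by rewrite (inj_eq val_inj).
by case: (P i); case: (Q j) => //=; case: ltngtP ij.
Qed.

(** Along the boundary the bottom precedes the top, which gives the product; the top is traversed
    from right to left, which exchanges [P] and [Q] in the last term. *)
Lemma sum_boundary_rank m n (P Q : pred (endpoint m n)) :
  \sum_x \sum_y [&& P x, Q y & boundary_rank x < boundary_rank y] =
  ordered_pairs (P \o inl) (Q \o inl) + (\sum_i P (inl i)) * (\sum_i Q (inr i))
  + ordered_pairs (Q \o inr) (P \o inr).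
Proof.
rewrite big_sumType big_distrl -big_split /=; congr addn.
  apply: eq_bigr => i _; rewrite big_sumType big_distrr /=; congr addn.
  apply: eq_bigr => j _; rewrite mulnb (_ : i < _) ?andbT //.
  by have := ltn_ord i; lia.
rewrite [RHS]exchange_big; apply: eq_bigr => j _.
rewrite big_sumType /= big1 ?add0n => [|i _].
  apply: eq_bigr => j' _; rewrite ltn_add2l /= andbCA.
  congr (nat_of_bool [&& _, _ & _]).
  by have := ltn_ord j; have := ltn_ord j'; lia.
by rewrite (_ : (_ < _) = false) ?andbF //; have := ltn_ord i; lia.
Qed.

(** * Components of the glued graph and the composite tangle *)

Section GlueTheory.
Variables (m n p : nat) (f : TL m n) (g : TL n p).
Local Notation U := (glue_point m n p).
Local Notation outer := (@outer_point m n p).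

(** Extended by the identity to the points off each tangle, the two pairings become involutions of
    the glued points, and the points fixed by one of them are the outer endpoints. *)
Definition lower_partner (u : U) : U :=
  match u with inl x => inl (partner f x) | inr k => inr k end.

Definition upper_partner (u : U) : U :=
  match u with
  | inl (inl i) => inl (inl i)
  | inl (inr j) => @upper_point m n p (partner g (inl j))
  | inr k => @upper_point m n p (partner g (inr k))
  end.

Lemma upper_partnerE y :
  upper_partner (@upper_point m n p y) = @upper_point m n p (partner g y).
Proof. by case: y. Qed.

Lemma lower_partnerK : involutive lower_partner.
Proof. by case=> //= x; rewrite partnerK. Qed.

Lemma upper_partnerK : involutive upper_partner.
Proof. by case=> [[i|j]|k] //=; rewrite upper_partnerE partnerK. Qed.

Lemma glue_lower x : glue f g (inl x) (inl (partner f x)).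
Proof. by apply/orP; left; apply/existsP; exists x; rewrite !eqxx. Qed.

Lemma glue_upper y :
  glue f g (@upper_point m n p y) (@upper_point m n p (partner g y)).
Proof. by apply/orP; right; apply/existsP; exists y; rewrite !eqxx. Qed.

Lemma glueP u v : glue f g u v ->
  (exists2 x, u = inl x & v = inl (partner f x)) \/
  (exists2 y, u = @upper_point m n p y & v = @upper_point m n p (partner g y)).
Proof.
by case/orP=> /existsP[x /andP[/eqP-> /eqP->]]; [left | right]; exists x.
Qed.

Lemma glue_sym : symmetric (glue f g).
Proof.
suff W u v : glue f g u v -> glue f g v u by move=> u v; apply/idP/idP; apply: W.
case/glueP=> -[x -> ->].
  by rewrite -{2}[x](partnerK f); apply: glue_lower.
by rewrite -{2}[x](partnerK g); apply: glue_upper.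
Qed.

Let dihedral : rel U := fun u v => (v == lower_partner u) || (v == upper_partner u).

Lemma connect_glueE : connect (glue f g) =2 connect dihedral.
Proof.
have up w : connect (glue f g) w (upper_partner w).
  case: w => [[i|j]|k] /=; first exact: connect0.
    exact/connect1/(glue_upper (inl j)).
  exact/connect1/(glue_upper (inr k)).
have lo w : connect (glue f g) w (lower_partner w).
  by case: w => [x|k] /=; rewrite ?connect0 //; apply/connect1/glue_lower.
move=> u v; apply/idP/idP; apply: connect_sub => {}u {}v.
  case/glueP=> -[x -> ->]; apply/connect1/orP; [left|right] => //.
  by rewrite upper_partnerE.
by case/orP=> /eqP ->.
Qed.

Lemma outer_fixed z :
  (lower_partner (outer z) == outer z) (+) (upper_partner (outer z) == outer z).
Proof.
case: z => [i|k] /=; rewrite eqxx ?addbT ?addTb.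
  by rewrite (inj_eq inl_inj) partner_neq.
apply/eqP; have := partner_neq g (inr k).
by case: (partner g _) => // k' /eqP kk' [k'k]; apply: kk'; rewrite k'k.
Qed.

Lemma fixed_outer u :
  (lower_partner u == u) || (upper_partner u == u) -> exists z, u = outer z.
Proof.
case: u => [[i|j]|k] /=; first by exists (inl i).
  rewrite (inj_eq inl_inj) (negbTE (partner_neq _ _)) /=.
  have := partner_neq g (inl j); case: (partner g _) => //= j' /eqP jj' /eqP[j'j].
  by case: jj'; rewrite j'j.
by exists (inr k).
Qed.

Lemma outer_point_inj : injective outer.
Proof. by move=> [i|k] [i'|k'] //= []->. Qed.

(** The antipode of [outer z] is again fixed by one of the involutions, hence is an outer
    endpoint. *)
Lemma outer_antipode z : exists z', z' != z /\
  forall w, connect (glue f g) (outer z) (outer w) = (w == z) || (w == z').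
Proof.
have [u [zu uz ufix uP]] :=
  involution_antipode lower_partnerK upper_partnerK (outer_fixed z).
have [z' uE] := fixed_outer ufix; exists z'; split.
  by apply: contraNneq uz => <-; rewrite uE.
move=> w; rewrite connect_glueE; apply/idP/idP => [zw|/orP[]/eqP->].
- case: (uP _ zw) => [|/outer_point_inj->|].
  + by have := outer_fixed w; case: eqP.
  + by rewrite eqxx.
  + by rewrite uE => /outer_point_inj->; rewrite eqxx orbT.
- exact: connect0.
- by rewrite -uE.
Qed.

Section CrossingParity.
Variables A B : pred U.
Hypotheses (Af : forall x, A (lower_partner x) = A x).
Hypotheses (Ag : forall x, A (upper_partner x) = A x).
Hypotheses (Bf : forall x, B (lower_partner x) = B x).
Hypotheses (Bg : forall x, B (upper_partner x) = B x).
Hypothesis AB : forall x, ~~ (A x && B x).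

(* Comparing orders along the three boundaries, the numbers of ordered pairs
   for f, g and the outer boundary add up, modulo 2, to
   (|A_m| + |A_n|) (|B_n| + |B_p|), where both factors are even. *)
Lemma even_outer_crossings :
  ~~ odd (\sum_x \sum_y [&& A (outer x), B (outer y)
                          & boundary_rank x < boundary_rank y]).
Proof.
have Xf := even_crossings (@boundary_rank_inj m n) (partnerK f) (partner_neq f)
  (partner_noncrossing f) (A := A \o inl) (B := B \o inl)
  (fun x => Af (inl x)) (fun x => Bf (inl x)) (fun x => AB (inl x)).
have Agy y : A (@upper_point m n p (partner g y)) = A (@upper_point m n p y).
  by rewrite -upper_partnerE Ag.
have Bgy y : B (@upper_point m n p (partner g y)) = B (@upper_point m n p y).
  by rewrite -upper_partnerE Bg.
have Xg := even_crossings (@boundary_rank_inj n p) (partnerK g) (partner_neq g)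
  (partner_noncrossing g) (A := A \o @upper_point m n p)
  (B := B \o @upper_point m n p) Agy Bgy (fun x => AB _).
have EA := even_closed (@boundary_rank_inj m n) (partnerK f) (partner_neq f)
  (A := A \o inl) (fun x => Af (inl x)).
have EB := even_closed (@boundary_rank_inj n p) (partnerK g) (partner_neq g)
  (A := B \o @upper_point m n p) Bgy.
have ABN := @ordered_pairsC n (A \o inl \o inr) (B \o inl \o inr) (fun x => AB _).
move: Xf Xg EA EB ABN.
rewrite (sum_boundary_rank (A \o inl) (B \o inl)).
rewrite (sum_boundary_rank (A \o @upper_point m n p) (B \o @upper_point m n p)).
rewrite (sum_boundary_rank (A \o outer) (B \o outer)) !big_sumType /=.
have -> : ordered_pairs ((A \o @upper_point m n p) \o inl)
  ((B \o @upper_point m n p) \o inl)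
  = ordered_pairs ((A \o inl) \o inr) ((B \o inl) \o inr) by [].
have -> : ordered_pairs ((A \o outer) \o inl) ((B \o outer) \o inl)
  = ordered_pairs ((A \o inl) \o inl) ((B \o inl) \o inl) by [].
have -> : ordered_pairs ((B \o outer) \o inr) ((A \o outer) \o inr)
  = ordered_pairs ((B \o @upper_point m n p) \o inr)
      ((A \o @upper_point m n p) \o inr) by [].
move=> + + + + /(congr1 odd); rewrite !(oddD, oddM).
by do 9 ?case: (odd _).
Qed.
End CrossingParity.

(** [is_composite] asks only that each endpoint be connected to its partner; [outer_antipode] rules
    out any further connection. *)
Lemma is_compositeP h : reflect
  (forall z w, connect (glue f g) (outer z) (outer w) = (w == z) || (w == partner h z))
  (is_composite f g h).
Proof.
apply: (iffP forallP) => [hP z w|zP z]; last by rewrite zP eqxx orbT.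
have [z' [_ zP]] := outer_antipode z; rewrite zP.
have := hP z; rewrite zP => /orP[|/eqP -> //].
by rewrite (negbTE (partner_neq _ _)).
Qed.

(** The antipodes define the pairing. If two arcs crossed, their components would have three ordered
    pairs of outer endpoints, against [even_outer_crossings]. *)
Lemma composite_ex : exists h, is_composite f g h.
Proof.
(* The default [z] is never returned, since an antipode always exists. *)
pose other z := odflt z [pick w | (w != z) && connect (glue f g) (outer z) (outer w)].
have otherP z : other z != z /\
    forall w, connect (glue f g) (outer z) (outer w) = (w == z) || (w == other z).
  have [z' [z'z zP]] := outer_antipode z; suff -> : other z = z' by [].
  rewrite /other; case: pickP => [w|/(_ z')] /=; rewrite zP.
    by case: eqVneq => //= _ /eqP.
  by rewrite z'z eqxx orbT.
have symg := sym_connect_sym glue_sym.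
have otherK : involutive other.
  move=> z; have [oz zP] := otherP z; have [_ ozP] := otherP (other z).
  have := ozP z; rewrite symg zP eqxx orbT eq_sym (negbTE oz) /=.
  by move=> /esym/eqP.
have TLh : is_TL [ffun z => other z].
  apply/and3P; split; apply/forallP => x.
  - by rewrite !ffunE otherK.
  - by rewrite ffunE; case: (otherP x).
  apply/forallP => y; rewrite !ffunE; apply/negP => /and3P[xy yox oxoy].
  have [xox xP] := otherP x; have [yoy yP] := otherP y.
  pose A := connect (glue f g) (outer x); pose B := connect (glue f g) (outer y).
  have closedf a u : connect (glue f g) a (lower_partner u) = connect (glue f g) a u.
    apply/esym; apply: (same_connect_r symg); rewrite connect_glueE.
    by rewrite connect1 // /dihedral eqxx.
  have closedg a u : connect (glue f g) a (upper_partner u) = connect (glue f g) a u.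
    apply/esym; apply: (same_connect_r symg); rewrite connect_glueE.
    by rewrite connect1 // /dihedral eqxx orbT.
  (* A common point would connect [x] to [y], forcing [y] to be [x] or [other x], against the strict
     inequalities. *)
  have AB u : ~~ (A u && B u).
    apply/negP => /andP[Au]; rewrite /B symg => uy.
    have := connect_trans Au uy; rewrite xP => /orP[]/eqP yE; move: xy yox; rewrite yE.
      by rewrite ltnn.
    by rewrite ltnn.
  have := @even_outer_crossings A B (closedf _) (closedg _) (closedf _) (closedg _) AB.
  rewrite (sum_pair xox) => [|z zx zox]; last first.
    by rewrite /A big1 // => w _; rewrite xP (negbTE zx) (negbTE zox).
  rewrite !(sum_pair yoy) => [|z zx zoy|z zx zoy]; last 2 first.
  - by rewrite /B yP (negbTE zx) (negbTE zoy) andbF.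
  - by rewrite /B yP (negbTE zx) (negbTE zoy) andbF.
  (* Of the four pairs, all but ([other x], [y]) are increasing: an odd number. *)
  have oxy : (boundary_rank (other x) < boundary_rank y) = false.
    by apply/negbTE; rewrite -leqNgt ltnW.
  have xoy := ltn_trans xy (ltn_trans yox oxoy).
  by rewrite /A /B !xP !yP !eqxx !orbT /= xy oxoy oxy xoy.
exists (Sub _ TLh); apply/forallP => z; rewrite /partner SubK ffunE.
by case: (otherP z) => _ ->; rewrite eqxx orbT.
Qed.

Definition TL_comp : TL m p := xchoose composite_ex.

Lemma connect_glue_outer z w :
  connect (glue f g) (outer z) (outer w) = (w == z) || (w == partner TL_comp z).
Proof. by move: z w; apply/is_compositeP; apply: xchooseP. Qed.

Lemma is_compositeE h : is_composite f g h = (h == TL_comp).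
Proof.
apply/idP/eqP => [/is_compositeP hP|->]; last exact: xchooseP composite_ex.
apply/val_inj/ffunP => z; have := hP z (partner h z).
rewrite connect_glue_outer eqxx orbT => /orP[|/eqP//].
by rewrite (negbTE (partner_neq _ _)).
Qed.

End GlueTheory.

(** * Counting circles *)

Lemma connect_involution (T : finType) (f : T -> T) : involutive f ->
  forall x y, connect (fun u v => v == f u) x y = (y == x) || (y == f x).
Proof.
move=> fK x y; apply/idP/idP => [|/orP[]/eqP->]; last 2 first.
- exact: connect0.
- by apply: connect1; rewrite eqxx.
case/connectP=> p; elim/last_ind: p y => [|p v IHp] y /=.
  by move=> _ ->; rewrite eqxx.
rewrite rcons_path last_rcons => /andP[/IHp/(_ erefl)/orP[]/eqP-> /eqP->] ->.
  by rewrite eqxx orbT.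
by rewrite fK eqxx.
Qed.

Lemma partner_TL0 n (c : TL 0 n) j : exists j', partner c (inr j) = inr j'.
Proof. by case: (partner c _) => [[]|j'] //; exists j'. Qed.

Lemma partner_rot m n (f : TL m n) x :
  partner (TL_rot f) x = swap_ends (partner f (swap_ends x)).
Proof. by rewrite {1}/partner SubK ffunE. Qed.

Lemma partner_rel_sym m n (f : TL m n) : symmetric (fun x y => y == partner f x).
Proof. by move=> x y; apply/eqP/eqP => ->; rewrite partnerK. Qed.

Lemma swap_ends_sym n : symmetric (fun x y : endpoint n n => y == swap_ends x).
Proof. by move=> [i|i] [j|j] //=; apply/eqP/eqP => -[->]. Qed.

Lemma partner_comp m n p (f : TL m n) (g : TL n p) z w : w != z ->
  glue f g (@outer_point m n p z) (@outer_point m n p w) ->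
  partner (TL_comp f g) z = w.
Proof.
move=> wz /connect1; rewrite connect_glue_outer (negbTE wz) /=.
by move/eqP.
Qed.

(** Closing a glued diagram up by [s] keeps its inner circles and otherwise sees only the composite
    tangle. *)
Lemma n_comp_glue_extend m n p (f : TL m n) (g : TL n p) (s : rel (endpoint m p)) :
    symmetric s ->
  n_comp (extend_rel (glue f g) (@outer_point m n p) s) (glue_point m n p) =
  circles f g
    + n_comp [rel x y | (y == partner (TL_comp f g) x) || s x y] (endpoint m p).
Proof.
move=> syms; rewrite (n_comp_extend (r := fun x y => y == partner (TL_comp f g) x)) //.
- exact: glue_sym.
- exact: partner_rel_sym.
by move=> z w; rewrite connect_glue_outer connect_involution //; apply: partnerK.
Qed.

Definition union_rel n (a b : TL 0 n) : rel (endpoint 0 n) :=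
  [rel x y | (y == partner a x) || (y == partner b x)].

(** Rotation keeps the left-to-right order, so stacking the rotated [b] on [a] superposes the two
    matchings on the same points. *)
Lemma circles_rot n (a b : TL 0 n) :
  circles a (TL_rot b) = n_comp (union_rel a b) (endpoint 0 n).
Proof.
(* There being no outer endpoints, [circles] counts every component. *)
rewrite /circles; transitivity (n_comp (glue a (TL_rot b)) (glue_point 0 n 0)).
  by apply: eq_n_comp_r => u; rewrite !inE; apply/forallP => -[[]|[]].
pose h (u : glue_point 0 n 0) : endpoint 0 n :=
  match u with inl x => x | inr k => inl k end.
have upE (x : endpoint 0 n) : inl x = @upper_point 0 n 0 (swap_ends x).
  by case: x => [[]|].
apply: (@n_comp_equiv _ _ _ _ h inl).
- by apply: sym_connect_sym; apply: glue_sym.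
- apply: sym_connect_sym => x y /=.
  by congr orb; [apply: (partner_rel_sym a)|apply: (partner_rel_sym b)].
- move=> u v /glueP[] [x -> ->]; apply: connect1; first by rewrite /union_rel /= eqxx.
  case: x => [j|[]//]; rewrite partner_rot /=.
  by have [j' bj] := partner_TL0 b j; rewrite bj; apply/orP; right; rewrite bj.
- move=> x y /orP[]/eqP->; apply: connect1; first exact: glue_lower.
  rewrite !upE (_ : swap_ends (partner b x) = partner (TL_rot b) (swap_ends x)).
    exact: glue_upper.
  by rewrite partner_rot; case: x => [[]|].
- by case=> [x|[]//]; apply: connect0.
- by move=> x; apply: connect0.
Qed.

Lemma circles_rotC n (a b : TL 0 n) : circles a (TL_rot b) = circles b (TL_rot a).
Proof.
rewrite !circles_rot; apply: eq_n_comp; apply: eq_connect => x y /=.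
exact: orbC.
Qed.

(** The gluing takes place along an empty boundary, so every point is outer. Hence the terms of
    [JW0] carry no circle factor. *)
Lemma circles_rot_comp n (a b : TL 0 n) : circles (TL_rot a) b = 0.
Proof.
apply: eq_card0 => u; rewrite !inE; apply/negP => /andP[_ /forallP uP].
case: u uP => [[i|[]//]|k] uP.
  by have := uP (inl i); rewrite connect0.
by have := uP (inr k); rewrite connect0.
Qed.

(* The circular closure of f and b \o a^rot is f closed off by b at the bottom
   and by a at the top. *)
Lemma circles_trace n (a b : TL 0 n) (f : TL n n) (h := TL_comp (TL_rot a) b) :
  circles f h + closure_circles (TL_comp f h) =
  circles b f + circles (TL_comp b f) (TL_rot a).
Proof.
(* The arcs of the rotated [a] and of [b] do not meet, so [h] pairs its bottom by [a] and its top by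
   [b]. *)
have ha j j' : partner a (inr j) = inr j' -> partner h (inl j) = inl j'.
  move=> aj; have jj' : (inl j' : endpoint n n) != inl j.
    by have := partner_neq a (inr j); rewrite aj; apply: contra => /eqP[->].
  apply: (partner_comp jj'); have := glue_lower (TL_rot a) b (inl j).
  by rewrite partner_rot /= aj.
have hb j j' : partner b (inr j) = inr j' -> partner h (inr j) = inr j'.
  move=> bj; have jj' : (inr j' : endpoint n n) != inr j.
    by have := partner_neq b (inr j); rewrite bj; apply: contra => /eqP[->].
  apply: (partner_comp jj'); have := glue_upper (TL_rot a) b (inr j).
  by rewrite bj.
(* Each side becomes the component count of one glued graph with closing edges: [f] and [h] closed
   circularly on the left, [b] and [f] closed by [a] on the right. *)
rewrite circles_rot -!n_comp_glue_extend; last 2 first.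
- exact: partner_rel_sym.
- exact: swap_ends_sym.
set e1 := extend_rel _ _ _; set e2 := extend_rel _ _ _.
have sym1 : symmetric e1.
  by apply: extend_rel_sym; [apply: glue_sym | apply: swap_ends_sym].
have sym2 : symmetric e2.
  by apply: extend_rel_sym; [apply: glue_sym | apply: partner_rel_sym].
have glue1 u v : glue f h u v -> e1 u v by rewrite /e1 /extend_rel => ->.
have glue2 u v : glue b f u v -> e2 u v by rewrite /e2 /extend_rel => ->.
have swap1 i : e1 (inr i) (inl (inl i)).
  apply/orP; right; apply/existsP; exists (inr i); apply/existsP; exists (inl i).
  by rewrite !eqxx.
have a2 j j' : partner a (inr j) = inr j' -> e2 (inr j) (inr j').
  move=> aj; apply/orP; right; apply/existsP; exists (inr j).
  by apply/existsP; exists (inr j'); rewrite !eqxx aj /=.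
(* [phi] identifies the top of [h] with the bottom of [f], which the circular closure joins; the top
   of [f] becomes the outer boundary, where [a] closes it. *)
pose phi (u : glue_point n n n) : glue_point 0 n n :=
  match u with
  | inl (inl i) => inl (inr i)
  | inl (inr j) => inr j
  | inr k => inl (inr k)
  end.
pose psi (u : glue_point 0 n n) : glue_point n n n :=
  match u with
  | inl (inl i) => match notF (ltn_ord i) with end
  | inl (inr j) => inl (inl j)
  | inr k => inl (inr k)
  end.
have phiE x : phi (inl x) = @upper_point 0 n n x by case: x.
have psiE x : psi (@upper_point 0 n n x) = inl x by case: x.
apply: (@n_comp_equiv _ _ _ _ phi psi).
- exact: sym_connect_sym.
- exact: sym_connect_sym.
- move=> u v /orP[/glueP[] [x -> ->]
                 |/existsP[z /existsP[w /and3P[/eqP-> /eqP-> /eqP->]]]].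
  + by rewrite !phiE; apply/connect1/glue2/glue_upper.
  + case: x => j; apply: connect1.
      by have [j' aj] := partner_TL0 a j; rewrite (ha _ _ aj) /=; apply: a2.
    have [j' bj] := partner_TL0 b j; rewrite (hb _ _ bj) /=; apply: glue2.
    by rewrite -bj; apply: glue_lower.
  + by case: z => i; apply: connect0.
- move=> u v /orP[/glueP[] [x -> ->]
                 |/existsP[z /existsP[w /and3P[/eqP-> /eqP-> /eqP->]]]].
  (* The arc of [b] sits at the top of [h], so it is reached through the closing edges at its two
     ends. *)
  + case: x => [[]//|j]; have [j' bj] := partner_TL0 b j; rewrite bj /=.
    apply: connect_trans (_ : connect e1 (inr j) _).
      by rewrite (sym_connect_sym sym1) connect1.
    apply: connect_trans (connect1 (swap1 j')).
    by apply/connect1/glue1; have := glue_upper f h (inr j); rewrite (hb _ _ bj).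
  + by rewrite !psiE; apply/connect1/glue1/glue_lower.
  + case: z => [[]//|j]; have [j' aj] := partner_TL0 a j; rewrite aj /=.
    by apply/connect1/glue1; have := glue_upper f h (inl j); rewrite (ha _ _ aj).
- by case=> [[i|j]|k] /=; rewrite ?connect0 // connect1.
- by case=> [[[]//|j]|k] /=; rewrite connect0.
Qed.

(** * Laurent polynomials and the trace *)

Local Open Scope ring_scope.

Lemma qhalf_neq0 : qhalf != 0.
Proof. by rewrite /qhalf tofrac_eq0 polyX_eq0. Qed.

Lemma is_laurent_tofrac p : is_laurent (tofrac p).
Proof. by exists p, 0%N; rewrite expr0 divr1. Qed.

Lemma is_laurent0 : is_laurent 0.
Proof. by rewrite -tofrac0; apply: is_laurent_tofrac. Qed.

Lemma is_laurent1 : is_laurent 1.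
Proof. by rewrite -tofrac1; apply: is_laurent_tofrac. Qed.

Lemma is_laurent_qhalf : is_laurent qhalf.
Proof. exact: is_laurent_tofrac. Qed.

Lemma is_laurent_qhalfV : is_laurent qhalf^-1.
Proof. by exists 1, 1%N; rewrite tofrac1 expr1 div1r. Qed.

Lemma is_laurentD x y : is_laurent x -> is_laurent y -> is_laurent (x + y).
Proof.
move=> [p [k ->]] [r [l ->]]; exists (p * 'X ^+ l + r * 'X ^+ k), (k + l)%N.
by rewrite tofracD !tofracM !tofracXn exprD addf_div ?expf_neq0 ?qhalf_neq0.
Qed.

Lemma is_laurentM x y : is_laurent x -> is_laurent y -> is_laurent (x * y).
Proof.
move=> [p [k ->]] [r [l ->]]; exists (p * r), (k + l)%N.
by rewrite tofracM exprD mulf_div.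
Qed.

Lemma is_laurentN x : is_laurent x -> is_laurent (- x).
Proof. by move=> [p [k ->]]; exists (- p), k; rewrite tofracN mulNr. Qed.

Lemma is_laurentX x n : is_laurent x -> is_laurent (x ^+ n).
Proof.
move=> lx; elim: n => [|n IHn]; first exact: is_laurent1.
by rewrite exprS; apply: is_laurentM.
Qed.

Lemma is_laurent_sum (I : finType) (P : pred I) (F : I -> Qq) :
  (forall i, P i -> is_laurent (F i)) -> is_laurent (\sum_(i | P i) F i).
Proof.
by move=> lF; apply: big_ind => //; [apply: is_laurent0 | apply: is_laurentD].
Qed.

Lemma is_laurent_bool (b : bool) : is_laurent b%:R.
Proof. by case: b; [apply: is_laurent1 | apply: is_laurent0]. Qed.

Lemma is_laurent_circle_value n : is_laurent (circle_value ^+ n).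
Proof.
apply/is_laurentX/is_laurentN/is_laurentD; rewrite /q.
  exact/is_laurentX/is_laurent_qhalf.
by rewrite -exprVn; apply/is_laurentX/is_laurent_qhalfV.
Qed.

Definition laurent_coefs m n (x : QTL m n) : Prop := forall f, is_laurent (x f).

Lemma laurent_TLb m n (f : TL m n) : laurent_coefs (TLb f).
Proof. by move=> h; rewrite ffunE; apply: is_laurent_bool. Qed.

Lemma laurent_qcomp m n p (y : QTL n p) (x : QTL m n) :
  laurent_coefs y -> laurent_coefs x -> laurent_coefs (qcomp y x).
Proof.
move=> ly lx h; rewrite ffunE; apply: is_laurent_sum => f _.
apply: is_laurent_sum => g _; apply: is_laurentM; last exact: is_laurent_circle_value.
exact: is_laurentM.
Qed.

Lemma laurentZ m n a (x : QTL m n) :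
  is_laurent a -> laurent_coefs x -> laurent_coefs (a *: x).
Proof. by move=> la lx h; rewrite ffunE; apply: is_laurentM. Qed.

Lemma laurentD m n (x y : QTL m n) :
  laurent_coefs x -> laurent_coefs y -> laurent_coefs (x + y).
Proof. by move=> lx ly h; rewrite ffunE; apply: is_laurentD. Qed.

Lemma laurent_bracket m n (t : tangle m n) : laurent_coefs (bracket t).
Proof.
elim: t => [|k i t IHt|k i t IHt|k i over t IHt] /=; first exact: laurent_TLb.
- exact: laurent_qcomp (laurent_TLb _) IHt.
- exact: laurent_qcomp (laurent_TLb _) IHt.
apply: laurent_qcomp IHt; apply: laurentD; apply: laurentZ.
- by case: over; [apply: is_laurent_qhalf | apply: is_laurent_qhalfV].
- exact: laurent_TLb.
- by case: over; rewrite ?invrK; [apply: is_laurent_qhalfV | apply: is_laurent_qhalf].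
- exact: laurent_qcomp (laurent_TLb _) (laurent_TLb _).
Qed.

Lemma qcomp_TLb m n p (f : TL m n) (g : TL n p) :
  qcomp (TLb g) (TLb f) = circle_value ^+ circles f g *: TLb (TL_comp f g).
Proof.
apply/ffunP => h; rewrite !ffunE (bigD1 f) //= [X in _ + X]big1 ?addr0; last first.
  move=> f' /negbTE ff'; rewrite big1 // => g' _.
  by rewrite [TLb f f']ffunE ff' !mul0r.
rewrite big_mkcond (bigD1 g) //= big1 ?addr0 => [|g' /negbTE gg']; last first.
  by rewrite [TLb g g']ffunE gg' mulr0 mul0r if_same.
rewrite is_compositeE !ffunE !eqxx !mul1r /GRing.scale /=.
by case: eqP; rewrite ?mulr1 ?mulr0.
Qed.

Lemma bracket_S3_qcomp n (y x : QTL n n) :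
  bracket_S3 (qcomp y x) =
  \sum_f \sum_g x f * y g *
    circle_value ^+ (circles f g + closure_circles (TL_comp f g)).
Proof.
rewrite /bracket_S3; under eq_bigr => h _ do rewrite ffunE big_distrl.
rewrite exchange_big; apply: eq_bigr => f _.
under eq_bigr => h _ do rewrite big_distrl big_mkcond.
rewrite exchange_big; apply: eq_bigr => g _ /=.
rewrite -big_mkcond (eq_bigl _ _ (is_compositeE f g)) big_pred1_eq.
by rewrite exprD mulrA.
Qed.

Lemma JW0E n g : JW0 n g =
  \sum_(a < #|matching n|) \sum_(b < #|matching n|) invmx (gram n) a b *
    (g == TL_comp (TL_rot (enum_val a : matching n)) (enum_val b : matching n))%:R.
Proof.
rewrite /JW0 sum_ffunE; apply: eq_bigr => a _; rewrite sum_ffunE; apply: eq_bigr => b _.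
by rewrite ffunE qcomp_TLb circles_rot_comp expr0 scale1r ffunE.
Qed.

(* The closure is the trace of the action of f on the space spanned by the
   matchings: composing with the inverse Gram matrix extracts the coefficient
   of b in f \o b. *)
Lemma bracket_S3_JW0 n (x : QTL (2 * n) (2 * n)) : gram n \in unitmx ->
  bracket_S3 (qcomp (JW0 n) x) =
  \sum_f x f * \sum_(b : matching n)
    circle_value ^+ circles b f * (TL_comp b f == b)%:R.
Proof.
move=> unitG; rewrite bracket_S3_qcomp; apply: eq_bigr => f _.
pose S (g : TL (2 * n) (2 * n)) :=
  circle_value ^+ (circles f g + closure_circles (TL_comp f g)).
pose h (a b : 'I_#|matching n|) :=
  TL_comp (TL_rot (enum_val a : matching n)) (enum_val b : matching n).
transitivity (x f * \sum_(g : TL (2 * n) (2 * n)) JW0 n g * S g).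
  by rewrite big_distrr; apply: eq_bigr => g _ /=; rewrite mulrA.
congr (_ * _).
transitivity (\sum_(b < #|matching n|) \sum_(a < #|matching n|)
    invmx (gram n) a b * S (h a b)).
  transitivity (\sum_g \sum_(a < #|matching n|) \sum_(b < #|matching n|)
      invmx (gram n) a b * (g == h a b)%:R * S g).
    apply: eq_bigr => g _; rewrite JW0E big_distrl; apply: eq_bigr => a _.
    by rewrite big_distrl.
  rewrite exchange_big [RHS]exchange_big; apply: eq_bigr => a _.
  rewrite exchange_big; apply: eq_bigr => b _ /=.
  rewrite (bigD1 (h a b)) //=.
  by rewrite eqxx mulr1 big1 ?addr0 // => g /negbTE ->; rewrite mulr0 mul0r.
rewrite (big_enum_val (A := matching n)); apply: eq_bigr => b _.
(* The index of f o b among the matchings: the row of the Gram matrix that will appear. *)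
pose c := enum_rank (TL_comp (enum_val b : matching n) f : matching n).
have cE : enum_val c = TL_comp (enum_val b : matching n) f by rewrite enum_rankK.
transitivity (circle_value ^+ circles (enum_val b : matching n) f *
              \sum_a gram n c a * invmx (gram n) a b).
  rewrite big_distrr; apply: eq_bigr => a _ /=.
  (* By [circles_trace] the exponent splits into the circles of f o b, constant in [a], and a Gram
     exponent, which [circles_rotC] puts in row [c]. *)
  rewrite /S /h circles_trace exprD -cE mulrCA; congr (_ * _).
  by rewrite mulrC mxE circles_rotC.
(* The (c, b) entry of the Gram matrix times its inverse is 1 if f o b is the matching b, and 0
   otherwise. *)
have := congr1 (fun A : 'M_ _ => A c b) (mulmxV unitG); rewrite !mxE => ->.
by rewrite -cE (inj_eq enum_val_inj).
Qed.

Theorem theorem3p5 (n : nat) (t : tangle (2 * n) (2 * n)) :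
  is_laurent (bracket_S2S1 t).
Proof.
rewrite /bracket_S2S1; have lt := laurent_bracket t.
have lgram a b : is_laurent (gram n a b).
  by rewrite mxE; apply: is_laurent_circle_value.
have [unitG|nunitG] := boolP (gram n \in unitmx).
  rewrite bracket_S3_JW0 //; apply: is_laurent_sum => f _; apply: is_laurentM => //.
  apply: is_laurent_sum => b _; apply: is_laurentM; last exact: is_laurent_bool.
  exact: is_laurent_circle_value.
rewrite bracket_S3_qcomp; apply: is_laurent_sum => f _; apply: is_laurent_sum => g _.
apply: is_laurentM; last exact: is_laurent_circle_value.
apply: is_laurentM => //; rewrite JW0E invmx_out //.
apply: is_laurent_sum => a _; apply: is_laurent_sum => b _.
by apply: is_laurentM => //; apply: is_laurent_bool.
Qed.
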